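(* Let $k,\ell,n$ be positive integers, let $\sigma\in S_n$ and let $(P,Q)$ be the pair of standard Young tableaux corresponding to $\sigma$ under the RSK correspondence. Then $\sigma$ is $(k,\ell)$-quadrocrucial if and only if all of the following hold: (1) the number of columns in $P$ (and $Q$) is $k-1$; (2) the number of rows in $P$ (and $Q$) is $\ell-1$; (3) $P$ contains an increasing sequence of elements $p_{1,k-1}<p_{2,j_2}<\cdots<p_{\ell-1,j_{\ell-1}}$ for some column indices $j_2,\ldots,j_{\ell-1}$; (4) $P$ contains an increasing sequence of elements $p_{\ell-1,1}<p_{i_2,2}<\cdots<p_{i_{k-1},k-1}$ for some row indices $i_2,\ldots,i_{k-1}$; (5) $Q$ contains an increasing sequence of elements $q_{1,k-1}<q_{2,j'_2}<\cdots<q_{\ell-1,j'_{\ell-1}}$ for some column indices $j'_2,\ldots,j'_{\ell-1}$; (6) $Q$ contains an increasing sequence of elements $q_{\ell-1,1}<q_{i'_2,2}<\cdots<q_{i'_{k-1},k-1}$ for some row indices $i'_2,\ldots,i'_{k-1}$.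
   Context: $S_n$ is the set of permutations $\sigma=\sigma_1\cdots\sigma_n$ of $\{1,\ldots,n\}$ in one-line notation. The patterns $12\cdots m$ and $m(m-1)\cdots 1$ are denoted $i_m$ and $d_m$; a permutation contains $i_m$ (resp. $d_m$) if it has an increasing (resp. decreasing) subsequence of length $m$, and avoids it otherwise. For $1\le t\le n+1$ put $e_t(x)=x$ if $x<t$ and $e_t(x)=x+1$ if $x\ge t$. The extensions of $\sigma\in S_n$ to the right are $e_t(\sigma_1)\cdots e_t(\sigma_n)\,t$, to the left are $t\,e_t(\sigma_1)\cdots e_t(\sigma_n)$, from above are $\sigma_1\cdots\sigma_{t-1}(n+1)\sigma_t\cdots\sigma_n$, and from below are $(\sigma_1+1)\cdots(\sigma_{t-1}+1)\,1\,(\sigma_t+1)\cdots(\sigma_n+1)$, in each case for $1\le t\le n+1$. A permutation is $(k,\ell)$-quadrocrucial if it avoids $i_k$ and $d_\ell$ but each of its extensions to the right, to the left, from above and from below contains $i_k$ or $d_\ell$. RSK: $P$ is the insertion tableau obtained by row-inserting $\sigma_1,\ldots,\sigma_n$ successively into the empty tableau, and $Q$ is the recording tableau. $p_{i,j}$ and $q_{i,j}$ denote the entries of $P$ and $Q$ in row $i$ (from the top) and column $j$ (from the left). *)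

(* Defs.v *)
From mathcomp Require Import all_boot all_fingroup.

Set Implicit Arguments.
Unset Strict Implicit.
Unset Printing Implicit Defensive.

(* Words take values in {1, ..., n}, whereas 'I_n is {0, ..., n-1}. *)
Definition oneline (n : nat) (s : 'S_n) : seq nat :=
  [seq (s i : nat).+1 | i <- enum 'I_n].

Definition contains_incr (m : nat) (w : seq nat) : Prop :=
  exists u : seq nat, [/\ subseq u w, size u = m & sorted ltn u].

Definition contains_decr (m : nat) (w : seq nat) : Prop :=
  exists u : seq nat, [/\ subseq u w, size u = m & sorted gtn u].

(* The relabelling e_t is [bump t]: x if x < t, and x + 1 if x >= t. *)
Definition ext_right (t : nat) (w : seq nat) : seq nat := rcons (map (bump t) w) t.

Definition ext_left (t : nat) (w : seq nat) : seq nat := t :: map (bump t) w.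

Definition ext_above (t : nat) (w : seq nat) : seq nat :=
  take t.-1 w ++ (size w).+1 :: drop t.-1 w.

Definition ext_below (t : nat) (w : seq nat) : seq nat :=
  map succn (take t.-1 w) ++ 1 :: map succn (drop t.-1 w).

Definition quadrocrucial (k l : nat) (w : seq nat) : Prop :=
  [/\ ~ contains_incr k w,
      ~ contains_decr l w &
      forall t, 1 <= t <= (size w).+1 ->
        [/\ contains_incr k (ext_right t w) \/ contains_decr l (ext_right t w),
            contains_incr k (ext_left t w) \/ contains_decr l (ext_left t w),
            contains_incr k (ext_above t w) \/ contains_decr l (ext_above t w) &
            contains_incr k (ext_below t w) \/ contains_decr l (ext_below t w)]].

(* A tableau is the list of its rows, from the top. *)
Definition tableau := seq (seq nat).

(* Inserting x replaces the leftmost entry larger than x; that entry, if any,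
   is returned as the bumped value. *)
Fixpoint row_insert (x : nat) (r : seq nat) : seq nat * option nat :=
  if r is y :: r' then
    if x < y then (x :: r', Some y)
    else let: (r'', b) := row_insert x r' in (y :: r'', b)
  else ([:: x], None).

(* The second component is the index, counted from 0, of the row in which the
   new cell is created. *)
Fixpoint tab_insert (x : nat) (T : tableau) : tableau * nat :=
  if T is r :: T' then
    let: (r', b) := row_insert x r in
    if b is Some y then
      let: (T'', i) := tab_insert y T' in (r' :: T'', i.+1)
    else (r' :: T', 0)
  else ([:: [:: x]], 0).

Definition add_cell (T : tableau) (i a : nat) : tableau :=
  set_nth [::] T i (rcons (nth [::] T i) a).

(* xa = (letter to be inserted, its position in the word). *)
Definition RSK_step (PQ : tableau * tableau) (xa : nat * nat) : tableau * tableau :=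
  let: (P', i) := tab_insert xa.1 PQ.1 in (P', add_cell PQ.2 i xa.2).

Definition RSK (w : seq nat) : tableau * tableau :=
  foldl RSK_step ([::], [::]) (zip w (iota 1 (size w))).

Definition nrows (T : tableau) : nat := size T.

(* The first row of a Young tableau is a longest one. *)
Definition ncols (T : tableau) : nat := size (head [::] T).

(* Rows and columns are numbered from 1 in [has_cell] and [entry]; [entry] is
   meaningful only on cells of T. *)
Definition has_cell (T : tableau) (i j : nat) : bool :=
  (1 <= i <= size T) && (1 <= j <= size (nth [::] T i.-1)).

Definition entry (T : tableau) (i j : nat) : nat := nth 0 (nth [::] T i.-1) j.-1.

(* T_{1,c} < T_{2,j_2} < ... < T_{r,j_r} for some column indices j_2, ..., j_r. *)
Definition chain_by_rows (T : tableau) (r c : nat) : Prop :=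
  exists j : nat -> nat,
    [/\ j 1 = c,
        forall i, 1 <= i <= r -> has_cell T i (j i) &
        forall i, 1 <= i < r -> entry T i (j i) < entry T i.+1 (j i.+1)].

(* T_{r,1} < T_{i_2,2} < ... < T_{i_c,c} for some row indices i_2, ..., i_c. *)
Definition chain_by_cols (T : tableau) (r c : nat) : Prop :=
  exists i : nat -> nat,
    [/\ i 1 = r,
        forall j, 1 <= j <= c -> has_cell T (i j) j &
        forall j, 1 <= j < c -> entry T (i j) j < entry T (i j.+1) j.+1].

(* Main.v *)
Require Import Defs.
From mathcomp Require Import all_boot all_fingroup.
From mathcomp Require Import zify.

(** Criticality to the right or to the left only depends on the Knuth class of
    a word. Indeed, if [w] avoids both patterns, the extension of [w] to the
    right by [t] contains one of them if and only if [w] has an increasing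
    subsequence of length [k - 1] with letters [< t] or a decreasing one of
    length [l - 1] with letters [>= t]; and Knuth moves preserve the lengths of
    monotone subsequences, even after restriction to an interval of letters
    ([knuth_filter], [knuth_incr], [knuth_decr]). So [w] may be replaced by the
    reading word of its insertion tableau [P] ([knuth_tab_insert]).

    In a reading word everything is visible: an increasing subsequence uses
    each column at most once, a decreasing one each row at most once
    ([incr_reading], [decr_reading]). Hence [P] has at most [k - 1] columns and
    [l - 1] rows, and criticality forces equality. Among the increasing
    subsequences of length [k - 1], the first row has the smallest last letter,
    namely [a = P_{1,k-1}]. All right extensions therefore contain a forbidden
    pattern if and only if some decreasing subsequence of length [l - 1] has all letters [>= a];
    having one entry in each row, the last one in row 1, it must end with [a],
    and read backwards it is a chain by rows ([chain_by_rowsP]). The left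
    extensions give the chains by columns in the same way ([chain_by_colsP]).

    Extensions from above and below are extensions to the right and left of the
    inverse permutation, whose insertion tableau is [Q] ([RSK_inv]). That
    symmetry is proved by removing the largest letter: its presence at position
    [a] adds a cell to [P] and row-inserts [a] into [Q]
    ([RSK_biword_insert_max]), which is the last insertion step for the inverse.
    That [P] and [Q] have as many rows and as many columns follows, since a
    permutation and its inverse have monotone subsequences of the same
    lengths. *)

Set Implicit Arguments.
Unset Strict Implicit.
Unset Printing Implicit Defensive.

(** * Words containing a monotone subsequence *)

(** The order is a parameter, so that each fact is proved once and used for
    [ltn] and [gtn]; reversing a word exchanges an order with its converse. *)
Definition contains (R : rel nat) (m : nat) (w : seq nat) : Prop :=
  exists u, [/\ subseq u w, size u = m & sorted R u].

Lemma gtn_irr : irreflexive gtn. Proof. exact: ltnn. Qed.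
Lemma gtn_trans : transitive gtn. Proof. exact: rev_trans ltn_trans. Qed.

Lemma subseq_catP (T : eqType) (u A B : seq T) :
  subseq u (A ++ B) ->
  exists u1 u2, [/\ u = u1 ++ u2, subseq u1 A & subseq u2 B].
Proof.
move=> /subseqP[m]; rewrite size_cat => Em ->.
rewrite -{1}(cat_take_drop (size A) m) mask_cat; last first.
  by rewrite size_takel // Em leq_addr.
by exists (mask (take (size A) m) A), (mask (drop (size A) m) B); rewrite !mask_subseq.
Qed.

Lemma contains_sub R m v w : subseq v w -> contains R m v -> contains R m w.
Proof. by move=> vw [u [uv Eu Su]]; exists u; split=> //; apply: subseq_trans vw. Qed.

Lemma contains_rev (R : rel nat) m w :
  contains R m w -> contains (fun x y => R y x) m (rev w).
Proof.
move=> [u [uw Eu Su]]; exists (rev u).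
by rewrite size_rev subseq_rev rev_sorted.
Qed.

Lemma contains_revE (R : rel nat) m w :
  contains R m w <-> contains (fun x y => R y x) m (rev w).
Proof.
split; first exact: contains_rev.
by move/contains_rev; rewrite revK.
Qed.

Lemma contains_map (R : rel nat) (f : nat -> nat) m w :
  {mono f : x y / R x y} -> contains R m (map f w) <-> contains R m w.
Proof.
move=> fm; split=> [[u [uw Eu Su]]|[u [uw Eu Su]]].
  case/subseqP: uw => b Eb Eu'; exists (mask b w); rewrite mask_subseq.
  move: Eu Su; rewrite Eu' -map_mask size_map sorted_map => ->.
  by rewrite (eq_sorted (e' := R)).
exists (map f u); rewrite size_map sorted_map map_subseq //.
by rewrite (eq_sorted (e' := R)).
Qed.

(** A letter that no later letter can follow only ever occurs at the end of
    the chains through it. *)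
Lemma contains_insert_last R m A x B : transitive R ->
  {in B, forall z, ~~ R x z} ->
  contains R m.+1 (A ++ x :: B) <->
  contains R m.+1 (A ++ B) \/ contains R m [seq z <- A | R z x].
Proof.
move=> Rt xB; split.
  move=> [_ [/subseq_catP[u [[|y v] [-> uA]]]]].
    rewrite cats0 => _ Eu Su; left; exists u; split=> //.
    exact: subseq_trans uA (prefix_subseq _ _).
  rewrite [subseq _ _]/=; case: eqP => [->|_] vB; last first.
    by move=> Es Ss; left; exists (u ++ y :: v); split=> //; apply: cat_subseq.
  case: v vB => [|z v] vB; last first.
    have /xB : z \in B by apply: (mem_subseq vB); rewrite mem_head.
    rewrite sorted_pairwise // pairwise_cat /= => /negPf ->.
    by rewrite !andbF.
  rewrite size_cat addn1 => -[Eu] Su; right; exists u; split=> //; last first.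
    by apply: subseq_sorted Su => //; apply: prefix_subseq.
  rewrite subseq_filter uA andbT.
  by move: Su; rewrite sorted_pairwise // pairwise_cat allrel1r => /andP[].
case=> [|[u [uA Eu Su]]].
  by apply: contains_sub; apply: cat_subseq => //; apply: subseq_cons.
move: uA; rewrite subseq_filter => /andP[ux uA].
exists (u ++ [:: x]); split.
- by apply: cat_subseq; rewrite //= eqxx sub0seq.
- by rewrite size_cat addn1 Eu.
- by rewrite sorted_pairwise // pairwise_cat allrel1r ux -sorted_pairwise // Su.
Qed.

Lemma contains_insert_first R m A x B : transitive R ->
  {in A, forall z, ~~ R z x} ->
  contains R m.+1 (A ++ x :: B) <->
  contains R m.+1 (A ++ B) \/ contains R m [seq z <- B | R x z].
Proof.
move=> Rt xA; rewrite contains_revE rev_cat rev_cons cat_rcons.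
rewrite contains_insert_last; last first.
- by move=> z; rewrite mem_rev; apply: xA.
- exact: rev_trans.
by rewrite -rev_cat filter_rev -!contains_revE.
Qed.

(** * Knuth equivalence *)

(** [KnuthMoveL] and [KnuthMoveR] are mirror images of each other, and each is
    symmetric under reversal of the order of the letters: hence invariance of
    increasing and decreasing subsequences reduces to [contains_moveL]. *)
Inductive knuth : seq nat -> seq nat -> Prop :=
| KnuthRefl w : knuth w w
| KnuthSym v w : knuth v w -> knuth w v
| KnuthTrans u v w : knuth u v -> knuth v w -> knuth u w
| KnuthMoveL u v p q r : p < q < r ->
    knuth (u ++ [:: q; r; p] ++ v) (u ++ [:: q; p; r] ++ v)
| KnuthMoveR u v p q r : p < q < r ->
    knuth (u ++ [:: p; r; q] ++ v) (u ++ [:: r; p; q] ++ v).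

Lemma knuth_cat a b v w : knuth v w -> knuth (a ++ v ++ b) (a ++ w ++ b).
Proof.
elim=> [x|x y _|x y z _ IH1 _ IH2|x y p q r lt_pqr|x y p q r lt_pqr].
- exact: KnuthRefl.
- exact: KnuthSym.
- exact: KnuthTrans IH2.
- by have := KnuthMoveL (a ++ x) (y ++ b) lt_pqr; rewrite -!catA.
- by have := KnuthMoveR (a ++ x) (y ++ b) lt_pqr; rewrite -!catA.
Qed.

Lemma knuth_catr b v w : knuth v w -> knuth (v ++ b) (w ++ b).
Proof. exact: (@knuth_cat [::]). Qed.

Lemma knuth_catl a v w : knuth v w -> knuth (a ++ v) (a ++ w).
Proof. by move/(knuth_cat a [::]); rewrite !cats0. Qed.

Definition convex (A : pred nat) := forall p q r, p < q < r -> A p -> A r -> A q.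

(** A convex set of letters that contains the outer letters [p] and [r] of a
    Knuth move contains [q]; if it misses [p] or [r], both sides of the move
    are filtered to the same word. This is what lets bounds on the letters be
    transported along Knuth equivalence. *)
Lemma knuth_filter A v w : convex A -> knuth v w ->
  knuth (filter A v) (filter A w).
Proof.
move=> cA; elim=> [x|x y _|x y z _ IH1 _ IH2|x y p q r lt_pqr|x y p q r lt_pqr].
- exact: KnuthRefl.
- exact: KnuthSym.
- exact: KnuthTrans IH2.
- rewrite !filter_cat /=; have := cA _ _ _ lt_pqr.
  case: (A p) (A r) => [] [] => [->|_|_|_] //; try exact: KnuthRefl.
  exact: (KnuthMoveL _ _ lt_pqr).
- rewrite !filter_cat /=; have := cA _ _ _ lt_pqr.
  case: (A p) (A r) => [] [] => [->|_|_|_] //; try exact: KnuthRefl.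
  exact: (KnuthMoveR _ _ lt_pqr).
Qed.

(** The only chain that a move can destroy is one through [p; r]; as
    [q] lies between them, replacing [p] by [q] repairs it. *)
Lemma contains_moveL (R : rel nat) m u v p q r :
  transitive R -> irreflexive R -> R p q -> R q r ->
  contains R m (u ++ [:: q; r; p] ++ v) <-> contains R m (u ++ [:: q; p; r] ++ v).
Proof.
move=> Rt Ri pq qr; have pr := Rt _ _ _ pq qr.
have asym x y : R x y -> R y x = false.
  by move=> xy; apply/negP => /(Rt _ _ _ xy); rewrite Ri.
have [qp rp] := (asym _ _ pq, asym _ _ pr).
have subs s : pairwise R s -> subseq s [:: q; r; p] -> subseq s [:: q; p; r].
  move=> Ss /subseqP[b Eb Es]; move: Eb Ss; rewrite Es {s Es}.
  case: b => [|[] [|[] [|[] []]]] //= _; rewrite ?rp ?andbF //= => _;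
    rewrite ?sub0seq ?eqxx //=; do ?[case: eqP => //].
have subs' s : pairwise R s -> subseq s [:: q; p; r] ->
    subseq s [:: q; r; p] \/ s = [:: p; r].
  move=> Ss /subseqP[b Eb Es]; move: Eb Ss; rewrite Es {s Es}.
  case: b => [|[] [|[] [|[] []]]] //= _; rewrite ?qp ?andbF //= => _;
    try (by right); left; rewrite ?sub0seq ?eqxx //=; do ?[case: eqP => //].
split=> -[_ [/subseq_catP[u1 [_ [-> u1u /subseq_catP[u2 [u3 [-> u23 u3v]]]]]] Es]];
  rewrite sorted_pairwise // => Ss; have := Ss;
  rewrite !pairwise_cat => /and3P[A1 P1 /and3P[A2 P2 P3]].
  exists (u1 ++ u2 ++ u3); rewrite sorted_pairwise //; split=> //.
  by apply: cat_subseq => //; apply: cat_subseq => //; apply: subs.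
case: (subs' _ P2 u23) => [u23'|Eu2].
  exists (u1 ++ u2 ++ u3); rewrite sorted_pairwise //; split=> //.
  by apply: cat_subseq => //; apply: cat_subseq.
exists (u1 ++ [:: q; r] ++ u3); rewrite sorted_pairwise //; split.
- by apply: cat_subseq => //; apply: cat_subseq => //=; rewrite !eqxx.
- by rewrite -Es Eu2 !size_cat.
move: A1 A2; rewrite Eu2 !pairwise_cat P1 P3 !allrel_catr !allrel_consl !allrel_consr /= !andbT.
move=> /andP[/andP[u1p u1r] u13] /andP[_ ru3].
rewrite u1r u13 ru3 qr !andbT /=; apply/andP; split.
  by apply: sub_all u1p => x /= xp; apply: Rt pq.
by apply: sub_all ru3 => x /=; apply: Rt qr.
Qed.

Lemma contains_moveR (R : rel nat) m u v p q r :
  transitive R -> irreflexive R -> R p q -> R q r ->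
  contains R m (u ++ [:: p; r; q] ++ v) <-> contains R m (u ++ [:: r; p; q] ++ v).
Proof.
move=> Rt Ri pq qr; rewrite 2!(contains_revE R) !rev_cat -!catA.
by symmetry; apply: contains_moveL => // ? ? ? /[swap]; apply: Rt.
Qed.

Lemma knuth_incr m v w : knuth v w -> contains ltn m v <-> contains ltn m w.
Proof.
elim=> [//|x y _ <- //|x y z _ -> _ -> //|x y p q r /andP[pq qr]|x y p q r /andP[pq qr]].
  exact: (contains_moveL _ _ _ ltn_trans ltnn pq qr).
exact: (contains_moveR _ _ _ ltn_trans ltnn pq qr).
Qed.

Lemma knuth_decr m v w : knuth v w -> contains gtn m v <-> contains gtn m w.
Proof.
elim=> [//|x y _ <- //|x y z _ -> _ -> //|x y p q r /andP[pq qr]|x y p q r /andP[pq qr]].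
  symmetry; exact: (contains_moveL _ _ _ gtn_trans gtn_irr qr pq).
symmetry; exact: (contains_moveR _ _ _ gtn_trans gtn_irr qr pq).
Qed.

(** * The reading word of the insertion tableau *)

(** The inserted letter travels left past the larger letters of the row until
    it stands right after the letter it bumps. *)
Lemma knuth_bump_last y r x : sorted ltn (y :: r) -> x < y ->
  knuth (y :: r ++ [:: x]) (y :: x :: r).
Proof.
elim: r y => [|z r IH] y /=; first by move=> _ _; apply: KnuthRefl.
move=> /andP[yz zr] xy; apply: KnuthTrans (knuth_catl [:: y] (IH z zr _)) _.
  exact: ltn_trans yz.
by have := KnuthMoveL [::] r (p := x) (q := y) (r := z); rewrite xy yz; apply.
Qed.

(** Once bumped, [y] travels left past the smaller letters [a] of the row.
    Each of these moves needs a witness [e] right after [y] with [a < e < y]: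
    it is the new entry at the place of [y] or the entry next to [a], which is
    why the induction also follows the head of the modified row. *)
Lemma knuth_row_insert x r r' y : sorted ltn r -> x \notin r ->
  row_insert x r = (r', Some y) -> knuth (r ++ [:: x]) (y :: r').
Proof.
move=> Sr xr E; suff: knuth (r ++ [:: x]) (y :: r') /\
   (exists e s, [/\ r' = e :: s, e < y & forall z, z < x -> path ltn z r -> z < e])
  by case.
elim: r r' Sr xr E => [|a r IH] r' Sr; first by [].
rewrite inE negb_or => /andP[ax xr] /=.
case: ltnP => [xa [<- <-]|]; first by split; [apply: knuth_bump_last | exists x, r].
rewrite leq_eqVlt eq_sym (negPf ax) /= => lt_ax.
case E: (row_insert x r) => [r'' [b|]] //= [<- Eb]; rewrite {b}Eb in E.
have [K [e [s [Er' ey ze]]]] := IH _ (path_sorted Sr) xr E.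
split; last first.
  exists a, r''; split=> //; last by move=> z _ /andP[].
  by apply: ltn_trans ey; apply: ze.
apply: KnuthTrans (knuth_catl [:: a] K) _; rewrite Er' /=.
have := KnuthMoveR [::] s (p := a) (q := e) (r := y); apply.
by rewrite ey ze.
Qed.

(** Rows are read from the bottom to the top: the letters bumped out of a row
    are then inserted into the word that stands immediately to its left. *)
Definition reading (T : tableau) : seq nat := flatten (rev T).

Lemma reading_cons r T : reading (r :: T) = reading T ++ r.
Proof. by rewrite /reading rev_cons flatten_rcons. Qed.

Lemma row_insert_None x r r' : row_insert x r = (r', None) -> r' = rcons r x.
Proof.
elim: r r' => [|a r IH] r' /=; first by case.
case: ltnP => // _; case E: (row_insert x r) => [r'' [b|]] //= [<-].
by rewrite (IH _ E).
Qed.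

Lemma row_insert_perm x r r' y : row_insert x r = (r', Some y) ->
  perm_eq (x :: r) (y :: r').
Proof.
elim: r r' => [|a r IH] r' //=.
case: ltnP => [_ [<- <-]|_].
  by apply/seq.permP => p /=; rewrite addnCA.
case E: (row_insert x r) => [r'' [b|]] //= [<- Eb]; rewrite {b}Eb in E.
by move/seq.permP: (IH _ E) => K; apply/seq.permP => p; move: (K p) => /=; lia.
Qed.

Lemma row_insert_lt x r r' y : row_insert x r = (r', Some y) -> x < y.
Proof.
elim: r r' => [|a r IH] r' //=; case: ltnP => [? [_ <-]//|_].
by case E: (row_insert x r) => [r'' [b|]] //= [_ Eb]; rewrite Eb in E; apply: IH E.
Qed.

Lemma tab_insert_perm x T : perm_eq (flatten (tab_insert x T).1) (x :: flatten T).
Proof.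
elim: T x => [|r T IH] x //=.
case E: (row_insert x r) => [r' [y|]] /=; last first.
  rewrite (row_insert_None E) cat_rcons.
  by apply/seq.permP => p; rewrite /= !count_cat /=; lia.
move: (IH y); case: (tab_insert y T) => [T' i] /= K.
rewrite -cat_cons; have := row_insert_perm E; move/seq.permP: K => K /seq.permP K'.
by apply/seq.permP => p; move: (K p) (K' p); rewrite /= !count_cat /=; lia.
Qed.

Lemma knuth_tab_insert x T : all (sorted ltn) T -> uniq (x :: flatten T) ->
  knuth (reading T ++ [:: x]) (reading (tab_insert x T).1).
Proof.
elim: T x => [|r T IH] x; first by move=> _ _; apply: KnuthRefl.
move=> /= /andP[Sr ST]; rewrite mem_cat negb_or cat_uniq.
move=> /andP[/andP[xr xT] /and3P[Ur rT UT]].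
case E: (row_insert x r) => [r' [y|]] /=; last first.
  by rewrite !reading_cons (row_insert_None E) cats1 -rcons_cat; apply: KnuthRefl.
have yr : y \in r.
  have : y \in x :: r by rewrite (perm_mem (row_insert_perm E)) mem_head.
  by rewrite inE => /predU1P[yx|//]; have := row_insert_lt E; rewrite yx ltnn.
have yT : y \notin flatten T.
  by apply: contra rT => yT; apply/hasP; exists y.
have := IH y ST; rewrite /= yT UT => /(_ isT).
case: (tab_insert y T) => [T' i] /= K; rewrite !reading_cons -catA.
apply: KnuthTrans (knuth_catl _ (knuth_row_insert Sr xr E)) _.
by have := knuth_catr r' K; rewrite -catA.
Qed.

(** * Insertion tableaux are Young tableaux *)

(** Column strictness of two consecutive rows, by recursion along the rows like
    [row_insert], so that inductions on an insertion carry it directly. *)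
Fixpoint dominates (r s : seq nat) : bool :=
  match r, s with
  | _, [::] => true
  | x :: r', y :: s' => (x < y) && dominates r' s'
  | [::], _ :: _ => false
  end.

(** With nonempty rows, [nrows] is the length of the first column. *)
Definition is_tableau (T : tableau) :=
  [&& all (sorted ltn) T, sorted dominates T & all (fun r => r != [::]) T].

Lemma dominates0 r : dominates r [::]. Proof. by case: r. Qed.

Lemma row_insert_path x z r : z < x -> x \notin r -> path ltn z r ->
  path ltn z (row_insert x r).1.
Proof.
elim: r z => [|a r IH] z zx; first by rewrite /= zx.
rewrite inE negb_or /= => /andP[ax xr] /andP[za ar].
case: ltnP => [xa|]; first by rewrite /= zx; apply: path_le ar => //; apply: ltn_trans.
rewrite leq_eqVlt eq_sym (negPf ax) /= => lt_ax.
by have := IH a lt_ax xr ar; case: (row_insert x r) => r' b /= ->; rewrite za.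
Qed.

Lemma row_insert_sorted x r : x \notin r -> sorted ltn r ->
  sorted ltn (row_insert x r).1.
Proof.
case: r => [//|a r]; rewrite inE negb_or /= => /andP[ax xr] ar.
case: ltnP => [xa|]; first by rewrite /=; apply: path_le ar => //; apply: ltn_trans.
rewrite leq_eqVlt eq_sym (negPf ax) /= => lt_ax.
by have := row_insert_path lt_ax xr ar; case: (row_insert x r).
Qed.

Lemma dominates_row_insert x r s : dominates r s -> dominates (row_insert x r).1 s.
Proof.
elim: r s => [|a r IH] [|b s]; rewrite ?dominates0 //= => /andP[ab rs].
case: ltnP => [xa|_] /=; first by rewrite (ltn_trans xa ab).
by have := IH _ rs; case: (row_insert x r) => r' c /= ->; rewrite ab.
Qed.

(** Column strictness survives because bumping paths move weakly left: [y]
    leaves its column for a place no further to the right in the next row. *)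
Lemma dominates_bump x y r r' s : row_insert x r = (r', Some y) ->
  dominates r s -> dominates r' (row_insert y s).1.
Proof.
elim: r r' s => [//|a r IH] r' s /=; case: ltnP => [xa [<- <-]|ax].
  case: s => [|b s] /=; first by rewrite xa dominates0.
  by move=> /andP[ab rs]; rewrite ab /= xa.
case E: (row_insert x r) => [r'' [b|]] //= [<- Eb]; rewrite {b}Eb in E.
have ay := leq_ltn_trans ax (row_insert_lt E).
case: s => [|b s] /=; first by rewrite ay dominates0.
move=> /andP[ab rs]; case: ltnP => _ /=.
  by rewrite ay -[r'']/(r'', Some y).1 -E dominates_row_insert.
by have := IH _ _ E rs; case: (row_insert y s) => s' c /= ->; rewrite ab.
Qed.

Lemma head_tab_insert x T :
  head [::] (tab_insert x T).1 = (row_insert x (head [::] T)).1.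
Proof.
case: T => [//|r T] /=; case: (row_insert x r) => r' [y|//].
by case: (tab_insert y T).
Qed.

Lemma path_dominates r T :
  path dominates r T = dominates r (head [::] T) && sorted dominates T.
Proof. by case: T => [|s T] //=; rewrite dominates0. Qed.

Lemma row_insert_neq0 x r : (row_insert x r).1 != [::].
Proof.
by case: r => [//|a r] /=; case: ifP => // _; case: (row_insert x r).
Qed.

Lemma tab_insert_tableau x T : is_tableau T -> uniq (x :: flatten T) ->
  is_tableau (tab_insert x T).1.
Proof.
rewrite /is_tableau.
elim: T x => [//|r T IH] x; rewrite /= path_dominates.
move=> /and3P[/andP[Sr ST] /andP[rT DT] /andP[_ NT]].
rewrite mem_cat negb_or cat_uniq => /andP[/andP[xr xT] /and3P[Ur dT UT]] /=.
have := row_insert_sorted xr Sr; have := dominates_row_insert x rT.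
case E: (row_insert x r) => [r' [y|]] /=; last first.
  by move=> D ->; rewrite path_dominates D ST DT NT (row_insert_None E); case: (r).
have yr : y \in r.
  have : y \in x :: r by rewrite (perm_mem (row_insert_perm E)) mem_head.
  by rewrite inE => /predU1P[yx|//]; have := row_insert_lt E; rewrite yx ltnn.
have yT : y \notin flatten T.
  by apply: contra dT => yT; apply/hasP; exists y.
have := IH y; rewrite ST DT NT /= yT UT => /(_ isT isT) K _ Sr'.
have := head_tab_insert y T; case: (tab_insert y T) K => [T' i] /= /and3P[-> DT' ->] E'.
rewrite path_dominates DT' E' Sr' (dominates_bump E rT) /= andbT.
by have := row_insert_neq0 x r; rewrite E.
Qed.

(** * Inserting around a maximal letter; the symmetry of RSK *)

Lemma row_insert_big M r : all (gtn M) r -> row_insert M r = (rcons r M, None).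
Proof.
by elim: r => [//|a r IH] /= /andP[aM /IH ->]; rewrite ltnNge (ltnW aM).
Qed.

(** A letter larger than the whole row, standing at its end, is disturbed only
    by an insertion that would have extended the row. *)
Lemma row_insert_rcons_big x M r : x < M ->
  row_insert x (rcons r M) =
  let: (r', o) := row_insert x r in
  if o is Some y then (rcons r' M, Some y) else (r', Some M).
Proof.
move=> xM; elim: r => [|a r IH] /=; first by rewrite xM.
case: ltnP => // _; rewrite IH.
by case E: (row_insert x r) => [r' [y|]].
Qed.

Lemma tab_insert_big M T : all (gtn M) (flatten T) ->
  tab_insert M T = (add_cell T 0 M, 0).
Proof.
case: T => [//|r T] /=; rewrite all_cat => /andP[rM _].
by rewrite row_insert_big.
Qed.

(** The local rule behind the symmetry of RSK. Without [M], the insertion of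
    [x] adds a cell in some row [j]. It does not notice [M] unless that cell
    is the one taken by [M]; then [M] is bumped and, being maximal, settles at
    the end of the next row. *)
Lemma tab_insert_add_big x M T i : x < M -> all (gtn M) (flatten T) ->
  tab_insert x (add_cell T i M) =
  let: (T', j) := tab_insert x T in
  if j == i then (add_cell T' i.+1 M, i.+1) else (add_cell T' i M, j).
Proof.
elim: T x i => [|r T IH] x [|i] xM.
- by rewrite /add_cell /= xM.
- by case: i => [|i].
- rewrite /= all_cat => /andP[rM TM]; rewrite /add_cell /= row_insert_rcons_big //.
  case: (row_insert x r) => r' [y|]; first by case: (tab_insert y T).
  by rewrite tab_insert_big.
rewrite -[add_cell (r :: T) i.+1 M]/(r :: add_cell T i M).
rewrite /= all_cat => /andP[rM TM]; case E: (row_insert x r) => [r' [y|]] //.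
have yM : y < M.
  have : all (gtn M) (x :: r) by rewrite /= xM.
  by rewrite (perm_all _ (row_insert_perm E)) => /andP[].
rewrite IH //.
by case: (tab_insert y T) => T' j; rewrite eqSS; case: eqP.
Qed.

Lemma add_cell_perm T i a : perm_eq (flatten (add_cell T i a)) (a :: flatten T).
Proof.
elim: T i => [|r T IH] [|i].
- by rewrite /add_cell.
- by rewrite /add_cell nth_nil /= -[ncons _ _ _]/(ncons i [::] [:: [:: a]]); elim: i.
- by rewrite /add_cell /= cat_rcons; apply/seq.permP => p; rewrite /= !count_cat /=; lia.
rewrite -[add_cell (r :: T) i.+1 a]/(r :: add_cell T i a) /=.
move/seq.permP: (IH i) => K; apply/seq.permP => p; move: (K p).
by rewrite /= !count_cat /=; lia.
Qed.

(** RSK on a list of (letter, position) pairs, where the positions need not be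
    consecutive: removing a letter from a permutation word leaves such a list. *)
Definition RSK_biword (X : seq (nat * nat)) := foldl RSK_step ([::], [::]) X.

Lemma RSK_biword_rcons X x : RSK_biword (rcons X x) = RSK_step (RSK_biword X) x.
Proof. by rewrite /RSK_biword foldl_rcons. Qed.

Lemma RSK_biword_perm X : perm_eq (flatten (RSK_biword X).1) (map fst X) /\
  perm_eq (flatten (RSK_biword X).2) (map snd X).
Proof.
elim/last_ind: X => [//|X [b c]]; rewrite RSK_biword_rcons !map_rcons.
case: (RSK_biword X) => P Q /= [IP IQ]; have := tab_insert_perm b P.
rewrite /RSK_step /=; case: (tab_insert b P) => P' i /= K.
split; rewrite perm_sym perm_rcons perm_sym.
  by apply: perm_trans K _; rewrite perm_cons.
by apply: perm_trans (add_cell_perm _ _ _) _; rewrite perm_cons.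
Qed.

(** Adding a point with maximal letter [M] at position [a] adds the cell [M] to
    [P] and row-inserts [a] into [Q]. Along the later steps [(b, c)] the two
    tableaux evolve in parallel: [tab_insert_add_big] applies in [P] to the
    insertion of [b] with maximal letter [M], and in [Q] to the insertion of
    [a] with maximal letter [c], and both collide under the same condition. *)
Lemma RSK_biword_insert_max M a X1 X2 :
  all (fun x => x.1 < M) (X1 ++ X2) ->
  sorted ltn (map snd (X1 ++ (M, a) :: X2)) ->
  RSK_biword (X1 ++ (M, a) :: X2) =
  let: (Q', i) := tab_insert a (RSK_biword (X1 ++ X2)).2 in
  (add_cell (RSK_biword (X1 ++ X2)).1 i M, Q').
Proof.
elim/last_ind: X2 => [|X2 [b c] IH].
  rewrite cats1 cats0 RSK_biword_rcons => lt_M.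
  rewrite map_rcons sorted_pairwise; last exact: ltn_trans.
  rewrite pairwise_rcons => /andP[lt_a _].
  have [] := RSK_biword_perm X1; case: (RSK_biword X1) => P Q /= HP HQ.
  rewrite /RSK_step /= !tab_insert_big // ?(perm_all _ HP) ?(perm_all _ HQ) //.
  by rewrite all_map.
rewrite -rcons_cons -!rcons_cat all_rcons => /andP[/= bM lt_M].
rewrite map_rcons sorted_pairwise; last exact: ltn_trans.
rewrite pairwise_rcons -sorted_pairwise; last exact: ltn_trans.
move=> /andP[lt_c S]; rewrite !RSK_biword_rcons IH //.
move: lt_c; rewrite map_cat all_cat /= => /and3P[c1 ac c2].
have [] := RSK_biword_perm (X1 ++ X2); case: (RSK_biword (X1 ++ X2)) => P Q /= HP HQ.
have PM : all (gtn M) (flatten P) by rewrite (perm_all _ HP) all_map.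
have Qc : all (gtn c) (flatten Q) by rewrite (perm_all _ HQ) map_cat all_cat c1.
case EQ: (tab_insert a Q) => [Q' i]; rewrite /RSK_step /=.
rewrite tab_insert_add_big //; case: (tab_insert b P) => P' j.
by case: eqVneq => [->|ji]; rewrite tab_insert_add_big // EQ ?eqxx // eq_sym (negPf ji).
Qed.

Definition swap_pair (x : nat * nat) := (x.2, x.1).

(** The last step of RSK on [Y] inserts the position of the largest letter of
    [X], which by [RSK_biword_insert_max] is also the effect on [Q] of adding
    that letter to the rest of [X]. *)
Lemma RSK_biword_swap X Y : sorted ltn (map snd X) -> sorted ltn (map snd Y) ->
  perm_eq Y (map swap_pair X) -> RSK_biword Y = ((RSK_biword X).2, (RSK_biword X).1).
Proof.
elim/last_ind: Y X => [|Y [a M] IH] X.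
  by move=> _ _ /perm_size; case: X.
move=> SX; rewrite map_rcons sorted_pairwise; last exact: ltn_trans.
rewrite pairwise_rcons -sorted_pairwise; last exact: ltn_trans.
move=> /andP[/= YM SY] YX.
have : (a, M) \in map swap_pair X by rewrite -(perm_mem YX) mem_rcons mem_head.
case/mapP=> -[M' a'] XMa [Ea EM]; rewrite -{}Ea -{}EM in XMa.
case/splitPr: XMa SX YX => X1 X2 SX YX.
have {}YX : perm_eq Y (map swap_pair (X1 ++ X2)).
  rewrite -(perm_cons (a, M)); move/seq.permP: YX => K; apply/seq.permP => p.
  by move: (K p); rewrite /swap_pair -cats1 !map_cat /= !count_cat /=; lia.
have SX' : sorted ltn (map snd (X1 ++ X2)).
  apply: subseq_sorted SX; first exact: ltn_trans.
  by rewrite map_subseq // cat_subseq // subseq_cons.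
rewrite RSK_biword_rcons RSK_biword_insert_max //.
  rewrite (IH _ SX' SY YX) /RSK_step /=.
  by case: (tab_insert a _).
have : all (gtn M) (map snd (map swap_pair (X1 ++ X2))).
  by rewrite -(perm_all _ (perm_map snd YX)).
by rewrite -map_comp all_map.
Qed.

Lemma RSK_biword_tableau X : uniq (map fst X) ->
  is_tableau (RSK_biword X).1 /\ knuth (map fst X) (reading (RSK_biword X).1).
Proof.
elim/last_ind: X => [|X [b c] IH]; first by split=> //; apply: KnuthRefl.
rewrite RSK_biword_rcons map_rcons rcons_uniq => /andP[bX UX].
have [TP KP] := IH UX; have [] := RSK_biword_perm X.
case: (RSK_biword X) TP KP => P Q /= TP KP HP _.
have U : uniq (b :: flatten P) by rewrite /= (perm_mem HP) (perm_uniq HP) bX.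
have := tab_insert_tableau TP U.
have := knuth_tab_insert (proj1 (andP TP)) U.
rewrite /RSK_step /=; case: (tab_insert b P) => P' i /= K T'; split=> //.
by rewrite -cats1; apply: KnuthTrans K; apply: knuth_catr.
Qed.

(** * Monotone subsequences of a reading word *)

Lemma dominates_trans : transitive dominates.
Proof.
move=> s r; elim: s r => [|y s IH] [|x r] [|z t] //= /andP[xy rs] /andP[yz st].
by rewrite (ltn_trans xy yz) (IH r t).
Qed.

Lemma dominates_nth r s j : dominates r s -> j < size s ->
  j < size r /\ nth 0 r j < nth 0 s j.
Proof.
elim: r s j => [|x r IH] [|y s] // [|j] /= /andP[xy rs] //.
exact: IH.
Qed.

Lemma pred_ltn i n : 0 < i <= n -> i.-1 < n. Proof. lia. Qed.

Section Tableau.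

Variable T : tableau.
Hypothesis tabT : is_tableau T.

Lemma entry_row i j' j : has_cell T i j -> 1 <= j' < j ->
  has_cell T i j' /\ entry T i j' < entry T i j.
Proof.
rewrite /has_cell /entry => /andP[Hi Hj] Hj'; split; first by rewrite Hi; lia.
have Sr : sorted ltn (nth [::] T i.-1).
  by case/and3P: tabT => /allP S _ _; apply: S; apply: mem_nth; apply: pred_ltn.
by apply: (sorted_ltn_nth ltn_trans 0 Sr) => //; rewrite ?inE; lia.
Qed.

Lemma entry_col i' i j : has_cell T i j -> 1 <= i' < i ->
  has_cell T i' j /\ entry T i' j < entry T i j.
Proof.
rewrite /has_cell /entry => /andP[Hi Hj] Hi'.
have D : dominates (nth [::] T i'.-1) (nth [::] T i.-1).
  case/and3P: tabT => _ S _.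
  by apply: (sorted_ltn_nth dominates_trans [::] S) => //; rewrite ?inE; lia.
by have [|? ?] := dominates_nth (j := j.-1) D; [lia | split=> //; lia].
Qed.

Lemma entry_le i' j' i j : has_cell T i j -> 1 <= i' <= i -> 1 <= j' <= j ->
  [/\ has_cell T i' j', entry T i' j' <= entry T i j &
      entry T i j <= entry T i' j' -> i' = i /\ j' = j].
Proof.
move=> H Hi Hj; have [H1 E1 F1] : [/\ has_cell T i' j, entry T i' j <= entry T i j &
  entry T i j <= entry T i' j -> i' = i].
  case: (eqVneq i' i) => [->|ne]; first by split.
  by have [|? ?] := entry_col H (i' := i'); [lia | split=> //; lia].
case: (eqVneq j' j) => [->|ne]; first by split=> // /F1.
by have [|? ?] := entry_row H1 (j' := j'); [lia | split=> //; lia].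
Qed.

Lemma has_cell_row1 j : has_cell T 1 j = (1 <= j <= ncols T).
Proof.
rewrite /has_cell /ncols nth0; case: (T) => [|r T'] //=.
by case: j.
Qed.

Lemma has_cell_col1 i : has_cell T i 1 = (1 <= i <= nrows T).
Proof.
rewrite /has_cell /nrows; apply: andb_idr => Hi.
case/and3P: tabT => _ _ /allP N.
have := N (nth [::] T i.-1) (mem_nth _ (pred_ltn Hi)).
by case: (nth _ _ _).
Qed.

Lemma has_cell_bounds i j : has_cell T i j ->
  (1 <= i <= nrows T) && (1 <= j <= ncols T).
Proof.
move=> H; have [H1 H2] := andP H; rewrite {1}/nrows H1 /= -has_cell_row1.
by have [||? _ _] := entry_le (i' := 1) (j' := j) H; lia.
Qed.

(** Cells in the order in which [reading] visits them. *)
Definition cells : seq (nat * nat) :=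
  [seq (i, j) | i <- rev (iota 1 (size T)), j <- iota 1 (size (nth [::] T i.-1))].

Definition reads_before (c d : nat * nat) : bool :=
  (d.1 < c.1) || (c.1 == d.1) && (c.2 < d.2).

Lemma reads_before_trans : transitive reads_before.
Proof. by move=> [a b] [c d] [e f]; rewrite /reads_before /=; lia. Qed.

Lemma reads_before_irr : irreflexive reads_before.
Proof. by move=> [a b]; rewrite /reads_before /=; lia. Qed.

Definition entry_at (c : nat * nat) := entry T c.1 c.2.

Lemma map_nth_iota1 (A : Type) (x0 : A) s :
  [seq nth x0 s i.-1 | i <- iota 1 (size s)] = s.
Proof. by rewrite (iotaDl 1 0) -map_comp -[RHS](mkseq_nth x0). Qed.

Lemma reading_cells : reading T = map entry_at cells.
Proof.
rewrite /cells map_flatten -map_comp /reading -{1}(map_nth_iota1 [::] T) -map_rev.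
by congr flatten; apply: eq_map => i /=; rewrite -map_comp [RHS]map_nth_iota1.
Qed.

Lemma mem_cells c : (c \in cells) = has_cell T c.1 c.2.
Proof.
case: c => i j; apply/allpairsPdep/idP => [[i' [j' []]]|].
  by rewrite mem_rev !mem_iota => Hi Hj [-> ->] /=; rewrite /has_cell; lia.
by rewrite /has_cell /= => H; exists i, j; rewrite mem_rev !mem_iota; split=> //; lia.
Qed.

Lemma sorted_cells : sorted reads_before cells.
Proof.
rewrite sorted_pairwise; last exact: reads_before_trans.
have : sorted gtn (rev (iota 1 (size T))) by rewrite rev_sorted iota_ltn_sorted.
rewrite sorted_pairwise /cells; last exact: gtn_trans.
elim: (rev _) => [//|i I IH] /=; rewrite pairwise_cat => /andP[iI /IH ->].
rewrite andbT; apply/andP; split.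
  apply/allrelP => _ _ /mapP[j _ ->] /allpairsPdep[i' [j' [i'I _ ->]]].
  by have /= lt_i := allP iI i' i'I; rewrite /reads_before /= lt_i.
have := iota_ltn_sorted 1 (size (nth [::] T i.-1)).
rewrite pairwise_map sorted_pairwise; last exact: ltn_trans.
by apply: sub_pairwise => j j' /= jj'; rewrite /reads_before /= eqxx jj' orbT.
Qed.

Lemma subseq_reading (R : rel nat) u : transitive R ->
  subseq u (reading T) -> sorted R u ->
  exists L, [/\ u = map entry_at L, all [in cells] L &
    pairwise (fun c d => reads_before c d && R (entry_at c) (entry_at d)) L].
Proof.
move=> Rt; rewrite reading_cells => /subseqP[b _ ->]; rewrite -map_mask => S.
exists (mask b cells); split=> //.
  by apply/allP => c; apply/mem_subseq/mask_subseq.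
rewrite (pairwise_relI reads_before) -sorted_pairwise; last exact: reads_before_trans.
rewrite (subseq_sorted reads_before_trans (mask_subseq _ _) sorted_cells).
by move: S; rewrite sorted_pairwise // pairwise_map.
Qed.

Lemma reading_subseq L : all [in cells] L -> sorted reads_before L ->
  subseq (map entry_at L) (reading T).
Proof.
move=> Lc SL; rewrite reading_cells map_subseq //.
suff -> : L = [seq c <- cells | c \in L] by apply: filter_subseq.
apply: (irr_sorted_eq reads_before_trans reads_before_irr) => //.
  exact: (sorted_filter reads_before_trans _ sorted_cells).
by move=> c; rewrite mem_filter; case: (boolP (c \in L)) => //= /(allP Lc).
Qed.

(** A cell read later stands weakly above; were it also weakly to the left, its
    entry would not be larger. *)
Lemma incr_reading u : subseq u (reading T) -> sorted ltn u ->
  exists L, [/\ u = map entry_at L, all [in cells] L & sorted ltn (map snd L)].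
Proof.
move=> uT Su; have [L [Eu Lc PL]] := subseq_reading ltn_trans uT Su.
exists L; split=> //; rewrite sorted_pairwise; last exact: ltn_trans.
rewrite pairwise_map; apply: sub_in_pairwise Lc PL => -[i j] [i' j'].
rewrite ?inE !mem_cells /reads_before /entry_at /= => H H' /andP[B E].
rewrite ltnNge; apply/negP => le_j.
have := andP H; have := andP H'; rewrite /has_cell => -[? ?] [? ?].
by have [] := entry_le (i' := i') (j' := j') H; lia.
Qed.

(** Within a row the entries read later are larger. *)
Lemma decr_reading u : subseq u (reading T) -> sorted gtn u ->
  exists L, [/\ u = map entry_at L, all [in cells] L & sorted gtn (map fst L)].
Proof.
move=> uT Su; have [L [Eu Lc PL]] := subseq_reading gtn_trans uT Su.
exists L; split=> //; rewrite sorted_pairwise; last exact: gtn_trans.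
rewrite pairwise_map; apply: sub_in_pairwise Lc PL => -[i j] [i' j'].
rewrite ?inE !mem_cells /reads_before /entry_at /= => H H' /andP[/orP[//|B] E].
have := andP H; have := andP H'; rewrite /has_cell => -[? ?] [? ?].
by have [] := entry_le (i' := i) (j' := j) H'; lia.
Qed.

Lemma size_sorted_iota s c : sorted ltn s -> {in s, forall j, 1 <= j <= c} ->
  size s <= c.
Proof.
move=> Ss sc; rewrite -(size_iota 1 c); apply: uniq_leq_size.
  exact: (sorted_uniq ltn_trans ltnn).
by move=> j /sc; rewrite mem_iota add1n ltnS.
Qed.

(** A monotone subsequence of maximal length visits every column (or every
    row) exactly once. *)
Lemma sorted_eq_iota s c : sorted ltn s -> {in s, forall j, 1 <= j <= c} ->
  size s = c -> s = iota 1 c.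
Proof.
move=> Ss sc Es; apply: (irr_sorted_eq ltn_trans ltnn) => //.
  exact: iota_ltn_sorted.
have Us : uniq s by apply: (sorted_uniq ltn_trans ltnn).
have sub : {subset s <= iota 1 c} by move=> j /sc; rewrite mem_iota add1n ltnS.
by case: (uniq_min_size Us sub); rewrite ?size_iota ?Es.
Qed.

Lemma sorted_map_iota (A : Type) (e : rel A) (f : nat -> A) c :
  (forall j, 1 <= j < c -> e (f j) (f j.+1)) -> sorted e (map f (iota 1 c)).
Proof.
move=> H; apply/(sortedP (f 0)) => i; rewrite size_map size_iota => ic.
by rewrite !(nth_map 0) ?size_iota ?nth_iota ?(ltnW ic) // add1n; apply: H; lia.
Qed.

(** The weak decrease of the row indices is what makes the chain a subsequence
    of the reading word. *)
Lemma incr_chain (A : pred nat) i c :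
  (forall j, 1 <= j <= c -> has_cell T (i j) j /\ A (entry T (i j) j)) ->
  (forall j, 1 <= j < c ->
     i j.+1 <= i j /\ entry T (i j) j < entry T (i j.+1) j.+1) ->
  contains ltn c (filter A (reading T)).
Proof.
move=> H1 H2; pose L := [seq (i j, j) | j <- iota 1 c].
exists (map entry_at L); rewrite !size_map size_iota; split=> //.
  rewrite subseq_filter; apply/andP; split.
    apply/allP => _ /mapP[_ /mapP[j Hj ->] ->].
    by move: Hj; rewrite mem_iota => Hj; have [] := H1 j; first lia.
  apply: reading_subseq.
    apply/allP => _ /mapP[j Hj ->]; rewrite ?inE mem_cells /=.
    by move: Hj; rewrite mem_iota => Hj; have [] := H1 j; first lia.
  by apply: sorted_map_iota => j /H2[? _]; rewrite /reads_before /=; lia.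
by rewrite -map_comp; apply: sorted_map_iota => j /H2[].
Qed.

(** Distinct rows are read one after the other, from the bottom up, hence the
    reversal. *)
Lemma decr_chain (A : pred nat) j r :
  (forall i, 1 <= i <= r -> has_cell T i (j i) /\ A (entry T i (j i))) ->
  (forall i, 1 <= i < r -> entry T i (j i) < entry T i.+1 (j i.+1)) ->
  contains gtn r (filter A (reading T)).
Proof.
move=> H1 H2; pose L := rev [seq (i, j i) | i <- iota 1 r].
exists (map entry_at L); rewrite size_map size_rev size_map size_iota; split=> //.
  rewrite subseq_filter; apply/andP; split.
    apply/allP => _ /mapP[x + ->]; rewrite mem_rev => /mapP[i Hi ->].
    by move: Hi; rewrite mem_iota => Hi; have [] := H1 i; first lia.
  apply: reading_subseq.
    apply/allP => x; rewrite mem_rev => /mapP[i Hi ->]; rewrite ?inE mem_cells /=.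
    by move: Hi; rewrite mem_iota => Hi; have [] := H1 i; first lia.
  rewrite rev_sorted.
  by apply: sorted_map_iota => i _; rewrite /reads_before /=; lia.
rewrite map_rev rev_sorted -map_comp; apply: sorted_map_iota => i /H2.
by [].
Qed.

Lemma incr_chain_inv (A : pred nat) : contains ltn (ncols T) (filter A (reading T)) ->
  exists i, (forall j, 1 <= j <= ncols T -> has_cell T (i j) j /\ A (entry T (i j) j)) /\
  (forall j, 1 <= j < ncols T -> entry T (i j) j < entry T (i j.+1) j.+1).
Proof.
move=> [u [+ Eu Su]]; rewrite subseq_filter => /andP[Au uT].
have [L [EL /allP Lc SL]] := incr_reading uT Su.
have ES : size L = ncols T by rewrite -Eu EL size_map.
have EI : map snd L = iota 1 (ncols T).
  apply: sorted_eq_iota SL _ _; rewrite ?size_map //.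
  move=> _ /mapP[c /Lc + ->]; rewrite mem_cells.
  by move/has_cell_bounds/andP/proj2.
pose d := (0, 0); exists (fun j => (nth d L j.-1).1).
have L2 j : 1 <= j <= ncols T -> nth d L j.-1 = ((nth d L j.-1).1, j).
  move=> Hj; rewrite [LHS]surjective_pairing; congr (_, _).
  have Hs : j.-1 < size L by rewrite ES; apply: pred_ltn.
  by rewrite -(nth_map d 0 snd Hs) EI nth_iota ?pred_ltn //; lia.
split=> j Hj.
  have Hn : nth d L j.-1 \in L by apply: mem_nth; rewrite ES; apply: pred_ltn.
  have := Lc _ Hn; rewrite mem_cells L2 // => -> /=; split=> //.
  by move/allP: Au => /(_ (entry_at (nth d L j.-1))); rewrite EL map_f // L2 //; apply.
have [j1 j2] : j.-1 < size L /\ j < size L by rewrite ES; lia.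
have Ej : j.-1.+1 = j by lia.
move/(sortedP 0)/(_ j.-1): Su; rewrite EL size_map Ej => /(_ j2).
rewrite (nth_map d 0 _ j1) (nth_map d 0 _ j2) /entry_at.
by rewrite L2 1?[nth d L j](L2 j.+1) //; lia.
Qed.

Lemma decr_chain_inv (A : pred nat) : contains gtn (nrows T) (filter A (reading T)) ->
  exists j, (forall i, 1 <= i <= nrows T -> has_cell T i (j i) /\ A (entry T i (j i))) /\
  (forall i, 1 <= i < nrows T -> entry T i (j i) < entry T i.+1 (j i.+1)).
Proof.
move=> [u [+ Eu Su]]; rewrite subseq_filter => /andP[Au uT].
have [L' [EL' /allP Lc' SL']] := decr_reading uT Su.
pose L := rev L'; have Lc c : c \in L -> c \in cells by rewrite mem_rev; apply: Lc'.
have EL : rev u = map entry_at L by rewrite EL' map_rev.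
have SL : sorted ltn (map fst L) by rewrite map_rev rev_sorted.
have {}Su : sorted ltn (rev u) by rewrite rev_sorted.
have {}Au : all A (rev u) by rewrite all_rev.
have {}Eu : size (rev u) = nrows T by rewrite size_rev.
have ES : size L = nrows T by rewrite -Eu EL size_map.
have EI : map fst L = iota 1 (nrows T).
  apply: sorted_eq_iota SL _ _; rewrite ?size_map //.
  move=> _ /mapP[c /Lc + ->]; rewrite mem_cells.
  by move/has_cell_bounds/andP/proj1.
pose d := (0, 0); exists (fun i => (nth d L i.-1).2).
have L1 i : 1 <= i <= nrows T -> nth d L i.-1 = (i, (nth d L i.-1).2).
  move=> Hi; rewrite [LHS]surjective_pairing; congr (_, _).
  have Hs : i.-1 < size L by rewrite ES; apply: pred_ltn.
  by rewrite -(nth_map d 0 fst Hs) EI nth_iota ?pred_ltn //; lia.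
split=> i Hi.
  have Hn : nth d L i.-1 \in L by apply: mem_nth; rewrite ES; apply: pred_ltn.
  have := Lc _ Hn; rewrite mem_cells L1 // => -> /=; split=> //.
  by move/allP: Au => /(_ (entry_at (nth d L i.-1))); rewrite EL map_f // L1 //; apply.
have [i1 i2] : i.-1 < size L /\ i < size L by rewrite ES; lia.
have Ei : i.-1.+1 = i by lia.
move/(sortedP 0)/(_ i.-1): Su; rewrite EL size_map Ei => /(_ i2).
rewrite (nth_map d 0 _ i1) (nth_map d 0 _ i2) /entry_at.
by rewrite L1 1?[nth d L i](L1 i.+1) //; lia.
Qed.

Lemma incr_readingE m : contains ltn m (reading T) <-> m <= ncols T.
Proof.
split=> [[u [uT <- Su]]|le_m].
  have [L [-> /allP Lc SL]] := incr_reading uT Su.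
  rewrite size_map -(size_map snd); apply: size_sorted_iota SL _.
  move=> _ /mapP[c /Lc + ->]; rewrite mem_cells.
  by move/has_cell_bounds/andP/proj2.
rewrite -(filter_predT (reading T)).
apply: (@incr_chain predT (fun _ => 1)) => j Hj.
  by rewrite has_cell_row1; split=> //; lia.
split=> //; have [||//] := @entry_row 1 j j.+1; last by lia.
by rewrite has_cell_row1; lia.
Qed.

Lemma decr_readingE m : contains gtn m (reading T) <-> m <= nrows T.
Proof.
split=> [[u [uT <- Su]]|le_m].
  have [L [-> /allP Lc SL]] := decr_reading uT Su.
  rewrite size_map -(size_map fst) -size_rev; apply: size_sorted_iota.
    by rewrite rev_sorted.
  move=> x; rewrite mem_rev => /mapP[c /Lc + ->]; rewrite mem_cells.
  by move/has_cell_bounds/andP/proj1.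
rewrite -(filter_predT (reading T)).
apply: (@decr_chain predT (fun _ => 1)) => i Hi.
  by rewrite has_cell_col1; split=> //; lia.
have [||//] := @entry_col i i.+1 1; last by lia.
by rewrite has_cell_col1; lia.
Qed.

End Tableau.

(** * Chains in a tableau and criticality of its reading word *)

Fixpoint running_min (f : nat -> nat) n :=
  if n is n'.+1 then minn (running_min f n') (f n) else f 1.

Lemma chain_ge_first (f : nat -> nat) c : (forall j, 1 <= j < c -> f j < f j.+1) ->
  forall j, 1 <= j <= c -> f 1 <= f j.
Proof.
move=> H; elim=> [//|[|j] IH] Hj //.
by apply: leq_trans (IH _) (ltnW (H _ _)); lia.
Qed.

Section Criticality.

Variables (T : tableau) (n : nat).
Hypothesis tabT : is_tableau T.
Hypothesis T_neq0 : 0 < nrows T.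
Hypothesis T_le : forall i j, has_cell T i j -> 1 <= entry T i j <= n.

Lemma ncols_gt0 : 0 < ncols T.
Proof.
have : has_cell T 1 1 by rewrite has_cell_col1 // T_neq0.
by rewrite has_cell_row1.
Qed.

(** A chain by columns may step down, and is then not a subsequence of the
    reading word. Replacing each row index by the minimum of those so far keeps
    the first cell and keeps the entries increasing, by row and column
    strictness. *)
Lemma normalize_chain_by_cols r c : chain_by_cols T r c -> exists i,
  [/\ i 1 = r, forall j, 1 <= j <= c -> has_cell T (i j) j &
      forall j, 1 <= j < c ->
        i j.+1 <= i j /\ entry T (i j) j < entry T (i j.+1) j.+1].
Proof.
move=> [i [i1 Hi Ei]]; exists (running_min i).
have E1 : running_min i 1 = i 1 by rewrite /= minnn.
have Hm j : 1 <= j <= c ->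
    has_cell T (running_min i j) j /\ running_min i j <= i j.
  elim: j => [//|[|j] IH] Hj; first by rewrite E1; split=> //; apply: Hi.
  have [|Hc le_i] := IH; first by lia.
  split; last exact: geq_minr.
  have H := Hi j.+2 Hj.
  rewrite [running_min _ _]/= -/(running_min i j.+1) /minn.
  case: ltnP => // lt_i; have b := has_cell_bounds tabT Hc.
  by have [||//] := @entry_le T tabT (running_min i j.+1) j.+2 _ _ H; lia.
split=> [|j|j Hj]; first by rewrite E1.
  by case/Hm.
have [|Hc le_i] := Hm j; first by lia.
have [|Hc' _] := Hm j.+1; first by lia.
have H : has_cell T (i j) j by apply: Hi; lia.
have bj := has_cell_bounds tabT Hc.
have E := Ei j Hj; split; first exact: geq_minl.
move: Hc'; rewrite [running_min _ j.+1]/= /minn.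
case: ltnP => le_i' Hc'.
  by have [|_] := entry_row tabT Hc' (j' := j); first lia.
by have [||_ le_E _] := @entry_le T tabT (running_min i j) j _ _ H; lia.
Qed.

(** Let [a] be the last entry of the first row. Every increasing subsequence of
    maximal length ends in the last column, so with an entry at least [a], and
    the first row itself ends with [a]: the first alternative holds exactly for
    [a < t], and only [t = a] matters for the second. A decreasing
    subsequence of maximal length ends in the first row, so if its letters are
    at least [a] it ends with [a] itself. *)
Lemma chain_by_rowsP :
  (forall t, 1 <= t <= n.+1 ->
    contains ltn (ncols T) [seq x <- reading T | x < t] \/
    contains gtn (nrows T) [seq x <- reading T | t <= x]) <->
  chain_by_rows T (nrows T) (ncols T).
Proof.
have Hc : has_cell T 1 (ncols T) by rewrite has_cell_row1 ncols_gt0 leqnn.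
split=> [H|[j [j1 Hj Ej]] t _].
  have [|/(incr_chain_inv tabT)[i [Hi _]]|/(decr_chain_inv tabT)[j [Hj Ej]]] :=
    H (entry T 1 (ncols T)).
  - by have := T_le Hc; lia.
  - have [|H1 /= lt_E] := Hi (ncols T); first by rewrite ncols_gt0 leqnn.
    have b := has_cell_bounds tabT H1; exfalso.
    by have [||_ le_E _] := @entry_le T tabT 1 (ncols T) _ _ H1; lia.
  exists j; split=> // [|i Hi]; last by have [] := Hj i Hi.
  have [|H1 /= le_E] := Hj 1; first by rewrite T_neq0.
  have := has_cell_bounds tabT H1 => b.
  by have [||_ _ /(_ le_E) []] := @entry_le T tabT 1 (j 1) _ _ Hc; lia.
case: (ltnP (entry T 1 (ncols T)) t) => [lt_t|le_t]; [left|right].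
  apply: (incr_chain tabT (i := fun=> 1)) => k Hk.
    have H1 : has_cell T 1 k by rewrite has_cell_row1.
    split=> //; apply: leq_ltn_trans lt_t.
    by have [||] := @entry_le T tabT 1 k _ _ Hc; lia.
  split=> //; have [||//] := @entry_row T tabT 1 k k.+1; last by lia.
  by rewrite has_cell_row1; lia.
apply: (decr_chain tabT (j := j)) => // i Hi; split; first exact: Hj.
by apply: leq_trans le_t _; rewrite -j1; apply: (chain_ge_first Ej).
Qed.

(** Same argument at the other corner: with [b] the first entry of the last
    row, the second alternative holds exactly for [b < t], as shown by the
    first column. *)
Lemma chain_by_colsP :
  (forall t, 1 <= t <= n.+1 ->
    contains ltn (ncols T) [seq x <- reading T | t <= x] \/
    contains gtn (nrows T) [seq x <- reading T | x < t]) <->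
  chain_by_cols T (nrows T) (ncols T).
Proof.
have Hc : has_cell T (nrows T) 1 by rewrite has_cell_col1 // T_neq0 leqnn.
split=> [H|/normalize_chain_by_cols[i [i1 Hi Ei]] t _].
  have [|/(incr_chain_inv tabT)[i [Hi Ei]]|/(decr_chain_inv tabT)[j [Hj _]]] :=
    H (entry T (nrows T) 1).
  - by have := T_le Hc; lia.
  - exists i; split=> // [|j Hj]; last by have [] := Hi j Hj.
    have [|H1 /= le_E] := Hi 1; first by rewrite ncols_gt0.
    have := has_cell_bounds tabT H1 => b.
    by have [||_ _ /(_ le_E) []] := @entry_le T tabT (i 1) 1 _ _ Hc; lia.
  have [|H1 /= lt_E] := Hj (nrows T); first by rewrite T_neq0 leqnn.
  have b := has_cell_bounds tabT H1; exfalso.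
  by have [||_ le_E _] := @entry_le T tabT (nrows T) 1 _ _ H1; lia.
case: (ltnP (entry T (nrows T) 1) t) => [lt_t|le_t]; [right|left].
  apply: (decr_chain tabT (j := fun=> 1)) => k Hk.
    have H1 : has_cell T k 1 by rewrite has_cell_col1.
    split=> //; apply: leq_ltn_trans lt_t.
    by have [||] := @entry_le T tabT k 1 _ _ Hc; lia.
  have [||//] := @entry_col T tabT k k.+1 1; last by lia.
  by rewrite has_cell_col1 //; lia.
apply: (incr_chain tabT (i := i)) => // j Hj; split; first exact: Hi.
apply: leq_trans le_t _; rewrite -i1.
by apply: (chain_ge_first (f := fun j => entry T (i j) j)) Hj => k /Ei[].
Qed.

End Criticality.

(** * Criticality of the extensions of a word *)

(** For a word without increasing subsequences of length [k.+1] and decreasing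
    ones of length [l.+1], this says that each extension to the right creates
    one of them; [t] is then the last letter of that subsequence. *)
Definition critical_right k l (w : seq nat) := forall t, 1 <= t <= (size w).+1 ->
  contains ltn k [seq x <- w | x < t] \/ contains gtn l [seq x <- w | t <= x].

Definition critical_left k l (w : seq nat) := forall t, 1 <= t <= (size w).+1 ->
  contains ltn k [seq x <- w | t <= x] \/ contains gtn l [seq x <- w | x < t].

Lemma bump_lt t : {mono bump t : x y / x < y}.
Proof. by move=> x y; rewrite /bump; lia. Qed.

Lemma bump_gt t : {mono bump t : x y / gtn x y}.
Proof. by move=> x y; rewrite /= bump_lt. Qed.

Lemma filter_bump_lt t w :
  [seq x <- map (bump t) w | x < t] = map (bump t) [seq x <- w | x < t].
Proof. by rewrite filter_map; congr map; apply: eq_filter => x /=; rewrite /bump; lia. Qed.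

Lemma filter_bump_gt t w :
  [seq x <- map (bump t) w | t < x] = map (bump t) [seq x <- w | t <= x].
Proof. by rewrite filter_map; congr map; apply: eq_filter => x /=; rewrite /bump; lia. Qed.

Section Extensions.

Variables (k l : nat) (w : seq nat).

Lemma incr_ext_right t : contains ltn k.+1 (ext_right t w) <->
  contains ltn k.+1 w \/ contains ltn k [seq x <- w | x < t].
Proof.
rewrite /ext_right -cats1 contains_insert_last //; last exact: ltn_trans.
by rewrite cats0 filter_bump_lt !contains_map //; apply: bump_lt.
Qed.

Lemma decr_ext_right t : contains gtn l.+1 (ext_right t w) <->
  contains gtn l.+1 w \/ contains gtn l [seq x <- w | t <= x].
Proof.
rewrite /ext_right -cats1 contains_insert_last //; last exact: gtn_trans.
by rewrite cats0 filter_bump_gt !contains_map //; apply: bump_gt.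
Qed.

Lemma incr_ext_left t : contains ltn k.+1 (ext_left t w) <->
  contains ltn k.+1 w \/ contains ltn k [seq x <- w | t <= x].
Proof.
rewrite /ext_left -[_ :: _]cat0s contains_insert_first //; last exact: ltn_trans.
by rewrite cat0s filter_bump_gt !contains_map //; apply: bump_lt.
Qed.

Lemma decr_ext_left t : contains gtn l.+1 (ext_left t w) <->
  contains gtn l.+1 w \/ contains gtn l [seq x <- w | x < t].
Proof.
rewrite /ext_left -[_ :: _]cat0s contains_insert_first //; last exact: gtn_trans.
by rewrite cat0s filter_bump_lt !contains_map //; apply: bump_gt.
Qed.

Hypothesis w_range : {in w, forall x, 1 <= x <= size w}.

(** The maximal letter is last in an increasing subsequence and first in a
    decreasing one; for extensions from below the roles are exchanged. *)
Lemma incr_ext_above t : contains ltn k.+1 (ext_above t w) <->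
  contains ltn k.+1 w \/ contains ltn k (take t.-1 w).
Proof.
rewrite /ext_above contains_insert_last ?cat_take_drop; last 2 first.
- exact: ltn_trans.
- by move=> x /mem_drop/w_range; lia.
rewrite (@eq_in_filter _ _ predT) ?filter_predT // => x /mem_take/w_range.
by move=> /= Hx; lia.
Qed.

Lemma decr_ext_above t : contains gtn l.+1 (ext_above t w) <->
  contains gtn l.+1 w \/ contains gtn l (drop t.-1 w).
Proof.
rewrite /ext_above contains_insert_first ?cat_take_drop; last 2 first.
- exact: gtn_trans.
- by move=> x /mem_take/w_range /=; lia.
rewrite (@eq_in_filter _ _ predT) ?filter_predT // => x /mem_drop/w_range.
by move=> /= Hx; lia.
Qed.

Lemma incr_ext_below t : contains ltn k.+1 (ext_below t w) <->
  contains ltn k.+1 w \/ contains ltn k (drop t.-1 w).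
Proof.
rewrite /ext_below contains_insert_first -?map_cat ?cat_take_drop; last 2 first.
- exact: ltn_trans.
- by move=> x /mapP[y _ ->].
rewrite (@eq_in_filter _ _ predT) ?filter_predT ?contains_map // => x.
by case/mapP=> y /mem_drop/w_range + ->; move=> /= Hy; lia.
Qed.

Lemma decr_ext_below t : contains gtn l.+1 (ext_below t w) <->
  contains gtn l.+1 w \/ contains gtn l (take t.-1 w).
Proof.
rewrite /ext_below contains_insert_last -?map_cat ?cat_take_drop; last 2 first.
- exact: gtn_trans.
- by move=> x /mapP[y _ ->].
rewrite (@eq_in_filter _ _ predT) ?filter_predT ?contains_map // => x.
by case/mapP=> y /mem_take/w_range + ->; move=> /= Hy; lia.
Qed.

End Extensions.

(** * Inverse permutations exchange positions and values *)

(** Both the prefixes or suffixes of [oneline s] and its restrictions to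
    intervals of values have this form. *)
Definition subword n (s : 'S_n) (B : pred 'I_n) : seq nat :=
  [seq (s i : nat).+1 | i <- enum 'I_n & B i].

Lemma sorted_enum n : sorted (fun i j : 'I_n => i < j) (enum 'I_n).
Proof. by have := iota_ltn_sorted 0 n; rewrite -val_enum_ord sorted_map. Qed.

Lemma ord_lt_trans n : transitive (fun i j : 'I_n => i < j).
Proof. by move=> i j k; apply: ltn_trans. Qed.

Lemma subword_contains R n (s : 'S_n) B m :
  contains R m (subword s B) <-> exists I : seq 'I_n,
    [/\ sorted (fun i j : 'I_n => i < j) I, all B I, size I = m &
        sorted R [seq (s i : nat).+1 | i <- I]].
Proof.
split=> [[u [/subseqP[b _ ->]]]|[I [SI BI Em SR]]].
  rewrite -map_mask size_map => Em SR; exists (mask b [seq i <- enum 'I_n | B i]).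
  split=> //.
    apply: subseq_sorted (sorted_enum n); first exact: ord_lt_trans.
    exact: subseq_trans (mask_subseq _ _) (filter_subseq _ _).
  by apply/allP => i /mem_mask; rewrite mem_filter => /andP[].
exists [seq (s i : nat).+1 | i <- I]; rewrite size_map; split=> //.
apply: map_subseq; rewrite subseq_filter BI.
suff -> : I = [seq i <- enum 'I_n | i \in I] by apply: filter_subseq.
apply: (irr_sorted_eq (@ord_lt_trans n)) => //.
- by move=> i; apply: ltnn.
- exact: sorted_filter (@ord_lt_trans n) _ _ (sorted_enum n).
- by move=> i; rewrite mem_filter mem_enum andbT.
Qed.

(** Increasing subsequences of [s] and of its inverse are the same sets of
    points, read by position and by value respectively. *)
Lemma incr_subword_inv n (s : 'S_n) B m : contains ltn m (subword s B) <->
  contains ltn m (subword s^-1 (fun i => B (s^-1 i)))%g.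
Proof.
suff H (r : 'S_n) A : contains ltn m (subword r A) ->
    contains ltn m (subword r^-1 (fun i => A (r^-1 i)))%g.
  split; first exact: H.
  move/H; rewrite invgK /subword (@eq_filter _ _ B) // => i.
  by rewrite permK.
move=> /subword_contains[I [SI AI Em SR]]; apply/subword_contains.
exists (map r I); rewrite size_map -map_comp; split=> //.
- by rewrite sorted_map; move: SR; rewrite sorted_map.
- by rewrite all_map (@eq_all _ _ A) // => i /=; rewrite permK.
rewrite sorted_map; apply: sub_sorted SI => i j /=.
by rewrite !permK.
Qed.

(** For a decreasing subsequence the two readings are opposite. *)
Lemma decr_subword_inv n (s : 'S_n) B m : contains gtn m (subword s B) <->
  contains gtn m (subword s^-1 (fun i => B (s^-1 i)))%g.
Proof.
suff H (r : 'S_n) A : contains gtn m (subword r A) ->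
    contains gtn m (subword r^-1 (fun i => A (r^-1 i)))%g.
  split; first exact: H.
  move/H; rewrite invgK /subword (@eq_filter _ _ B) // => i.
  by rewrite permK.
move=> /subword_contains[I [SI AI Em SR]]; apply/subword_contains.
exists (rev (map r I)); rewrite size_rev size_map; split=> //.
- by rewrite rev_sorted sorted_map; move: SR; rewrite sorted_map.
- by rewrite all_rev all_map (@eq_all _ _ A) // => i /=; rewrite permK.
rewrite map_rev rev_sorted -map_comp sorted_map; apply: sub_sorted SI => i j /=.
by rewrite !permK.
Qed.

Lemma size_oneline n (s : 'S_n) : size (oneline s) = n.
Proof. by rewrite size_map size_enum_ord. Qed.

Lemma oneline_range n (s : 'S_n) : {in oneline s, forall x, 1 <= x <= n}.
Proof. by move=> _ /mapP[i _ ->]; rewrite ltn_ord. Qed.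

Lemma oneline_uniq n (s : 'S_n) : uniq (oneline s).
Proof.
rewrite map_inj_uniq ?enum_uniq // => i j [] /val_inj; exact: perm_inj.
Qed.

Lemma oneline_subword n (s : 'S_n) : oneline s = subword s predT.
Proof. by rewrite /subword filter_predT. Qed.

Lemma filter_oneline n (s : 'S_n) A :
  filter A (oneline s) = subword s (fun i => A (s i).+1).
Proof. by rewrite /oneline filter_map. Qed.

Lemma filter_iota_ge p n : [seq i <- iota 0 n | p <= i] = iota p (n - p).
Proof.
apply: (irr_sorted_eq ltn_trans ltnn).
- exact: (sorted_filter ltn_trans _ (iota_ltn_sorted _ _)).
- exact: iota_ltn_sorted.
- by move=> i; rewrite mem_filter !mem_iota; lia.
Qed.

Lemma take_oneline n (s : 'S_n) p : p <= n ->
  take p (oneline s) = subword s (fun i => i < p).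
Proof.
move=> pn; rewrite -map_take; congr map; apply: (inj_map val_inj).
rewrite map_take val_enum_ord take_iota (minn_idPl pn).
by rewrite -(filter_map val (fun i => i < p)) val_enum_ord (filter_iota_ltn 0 pn).
Qed.

Lemma drop_oneline n (s : 'S_n) p :
  drop p (oneline s) = subword s (fun i => p <= i).
Proof.
rewrite -map_drop; congr map; apply: (inj_map val_inj).
rewrite map_drop val_enum_ord drop_iota.
by rewrite -(filter_map val (fun i => p <= i)) val_enum_ord filter_iota_ge.
Qed.

Lemma eq_subword n (s : 'S_n) B1 B2 : B1 =1 B2 -> subword s B1 = subword s B2.
Proof. by move=> /eq_filter EB; rewrite /subword EB. Qed.

(** * Quadrocrucial permutations *)

Lemma contains_take_inv n (s : 'S_n) t m : 1 <= t <= n.+1 ->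
  (contains ltn m (take t.-1 (oneline s)) <->
     contains ltn m [seq x <- oneline s^-1 | x < t]%g) /\
  (contains gtn m (take t.-1 (oneline s)) <->
     contains gtn m [seq x <- oneline s^-1 | x < t]%g).
Proof.
move=> Ht; rewrite take_oneline; last lia.
rewrite incr_subword_inv decr_subword_inv !filter_oneline.
rewrite (@eq_subword _ _ _ (fun i => ((s^-1)%g i).+1 < t)) // => i; lia.
Qed.

Lemma contains_drop_inv n (s : 'S_n) t m : 1 <= t ->
  (contains ltn m (drop t.-1 (oneline s)) <->
     contains ltn m [seq x <- oneline s^-1 | t <= x]%g) /\
  (contains gtn m (drop t.-1 (oneline s)) <->
     contains gtn m [seq x <- oneline s^-1 | t <= x]%g).
Proof.
move=> Ht; rewrite drop_oneline.
rewrite incr_subword_inv decr_subword_inv !filter_oneline.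
rewrite (@eq_subword _ _ _ (fun i => t <= ((s^-1)%g i).+1)) // => i; lia.
Qed.

(** The extensions of [s] from above and from below are the inverses of the
    extensions of its inverse to the right and to the left. *)
Lemma quadrocrucialE k l n (s : 'S_n) :
  quadrocrucial k.+1 l.+1 (oneline s) <->
  [/\ ~ contains ltn k.+1 (oneline s), ~ contains gtn l.+1 (oneline s),
      critical_right k l (oneline s) /\ critical_left k l (oneline s),
      critical_right k l (oneline s^-1)%g &
      critical_left k l (oneline s^-1)%g].
Proof.
have rng (r : 'S_n) : {in oneline r, forall x, 1 <= x <= size (oneline r)}.
  by rewrite size_oneline; apply: oneline_range.
rewrite /quadrocrucial /critical_right /critical_left !size_oneline.
rewrite -[contains_incr]/(contains ltn) -[contains_decr]/(contains gtn).
have inv t (Ht : 1 <= t <= n.+1) := (contains_take_inv s k Ht, contains_take_inv s l Ht,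
  contains_drop_inv s k (proj1 (andP Ht)), contains_drop_inv s l (proj1 (andP Ht))).
split=> [[Ni Nd H]|[Ni Nd [Hr Hl] Ha Hb]].
  split=> // [|t Ht|t Ht]; first split=> t Ht; have [[[T1 T2] D1] D2] := inv t Ht.
  - by have [+ _ _ _] := H t Ht; rewrite incr_ext_right decr_ext_right; tauto.
  - by have [_ + _ _] := H t Ht; rewrite incr_ext_left decr_ext_left; tauto.
  - by have [_ _ + _] := H t Ht; rewrite incr_ext_above // decr_ext_above //; tauto.
  - by have [_ _ _ +] := H t Ht; rewrite incr_ext_below // decr_ext_below //; tauto.
split=> // t Ht; have [[[T1 T2] D1] D2] := inv t Ht.
move: (Hr t Ht) (Hl t Ht) (Ha t Ht) (Hb t Ht) => {}Hr {}Hl {}Ha {}Hb; split.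
- by rewrite incr_ext_right decr_ext_right; tauto.
- by rewrite incr_ext_left decr_ext_left; tauto.
- by rewrite incr_ext_above // decr_ext_above //; tauto.
- by rewrite incr_ext_below // decr_ext_below //; tauto.
Qed.

Lemma RSK_oneline n (s : 'S_n) (P := (RSK (oneline s)).1) :
  [/\ is_tableau P, knuth (oneline s) (reading P) &
      perm_eq (flatten P) (oneline s)].
Proof.
have E : unzip1 (zip (oneline s) (iota 1 (size (oneline s)))) = oneline s.
  by rewrite unzip1_zip // size_iota.
rewrite {}/P /RSK -/(RSK_biword _); have [Hp _] := RSK_biword_perm (zip (oneline s) (iota 1 (size (oneline s)))).
have [] := @RSK_biword_tableau (zip (oneline s) (iota 1 (size (oneline s)))).
  by rewrite -/unzip1 E oneline_uniq.
by rewrite -/unzip1 E in Hp *.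
Qed.

Lemma zip_oneline n (s : 'S_n) :
  zip (oneline s) (iota 1 (size (oneline s))) =
  [seq ((s i : nat).+1, (i : nat).+1) | i <- enum 'I_n].
Proof.
have -> : iota 1 (size (oneline s)) = [seq (nat_of_ord i).+1 | i <- enum 'I_n].
  by rewrite size_oneline (iotaDl 1 0) -val_enum_ord -map_comp.
by rewrite zip_map.
Qed.

Lemma RSK_inv n (s : 'S_n) :
  RSK (oneline s^-1)%g = ((RSK (oneline s)).2, (RSK (oneline s)).1).
Proof.
have Ssnd (r : 'S_n) : sorted ltn
    (map snd [seq ((r i : nat).+1, (i : nat).+1) | i <- enum 'I_n]).
  by rewrite -map_comp sorted_map; apply: sub_sorted (sorted_enum n).
rewrite /RSK !zip_oneline; apply: RSK_biword_swap => //.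
rewrite -map_comp; set f := (X in perm_eq _ (map X _)).
have -> : [seq (((s^-1)%g i : nat).+1, (i : nat).+1) | i <- enum 'I_n] =
    map f (map (s^-1)%g (enum 'I_n)).
  by rewrite -map_comp; apply: eq_map => i; rewrite /f /swap_pair /= permKV.
apply: perm_map; apply: uniq_perm; rewrite ?enum_uniq //.
  by rewrite map_inj_uniq ?enum_uniq //; apply: perm_inj.
move=> i; rewrite mem_enum; apply/mapP; exists (s i); rewrite ?mem_enum //.
by rewrite permK.
Qed.

Section OneWord.

Variables (n : nat) (s : 'S_n) (P : tableau).
Hypothesis n_gt0 : 0 < n.
Hypothesis P_def : P = (RSK (oneline s)).1.

Lemma P_tableau : is_tableau P.
Proof. by rewrite P_def; have [] := RSK_oneline s. Qed.

Lemma P_entry i j : has_cell P i j -> 1 <= entry P i j <= n.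
Proof.
move=> /andP[/pred_ltn Hi /pred_ltn Hj]; have [_ _ HP] := RSK_oneline s.
apply: (@oneline_range _ s); rewrite -(perm_mem HP) -P_def.
by apply/flattenP; exists (nth [::] P i.-1); apply: mem_nth.
Qed.

Lemma P_neq0 : 0 < nrows P.
Proof.
have [_ _ HP] := RSK_oneline s; rewrite /nrows lt0n size_eq0; apply/eqP => P0.
by move/perm_size: HP; rewrite -P_def P0 size_oneline; case: n n_gt0.
Qed.

Lemma incr_onelineE m : contains ltn m (oneline s) <-> m <= ncols P.
Proof.
have [_ K _] := RSK_oneline s.
by rewrite (knuth_incr m K) -P_def incr_readingE //; apply: P_tableau.
Qed.

Lemma decr_onelineE m : contains gtn m (oneline s) <-> m <= nrows P.
Proof.
have [_ K _] := RSK_oneline s.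
by rewrite (knuth_decr m K) -P_def decr_readingE //; apply: P_tableau.
Qed.

Lemma convex_lt t : convex (fun x => x < t).
Proof. by move=> p q r; lia. Qed.

Lemma convex_ge t : convex (fun x => t <= x).
Proof. by move=> p q r; lia. Qed.

Lemma critical_rightE k l : ncols P = k -> nrows P = l ->
  critical_right k l (oneline s) <-> chain_by_rows P l k.
Proof.
move=> <- <-; rewrite -(chain_by_rowsP P_tableau P_neq0 P_entry).
have [_ K _] := RSK_oneline s; rewrite -P_def in K.
by rewrite /critical_right size_oneline; split=> H t /H;
  rewrite (knuth_incr _ (knuth_filter (convex_lt (t := t)) K))
          (knuth_decr _ (knuth_filter (convex_ge (t := t)) K)).
Qed.

Lemma critical_leftE k l : ncols P = k -> nrows P = l ->
  critical_left k l (oneline s) <-> chain_by_cols P l k.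
Proof.
move=> <- <-; rewrite -(chain_by_colsP P_tableau P_neq0 P_entry).
have [_ K _] := RSK_oneline s; rewrite -P_def in K.
by rewrite /critical_left size_oneline; split=> H t /H;
  rewrite (knuth_incr _ (knuth_filter (convex_ge (t := t)) K))
          (knuth_decr _ (knuth_filter (convex_lt (t := t)) K)).
Qed.

(** At [t = n.+1] no letter is [>= t], so the increasing subsequence of
    length [k] exists; at [t = 1] the decreasing one does. *)
Lemma critical_right_shape k l : ~ contains ltn k.+1 (oneline s) ->
  ~ contains gtn l.+1 (oneline s) -> critical_right k l (oneline s) ->
  ncols P = k /\ nrows P = l.
Proof.
rewrite incr_onelineE decr_onelineE /critical_right size_oneline => Hk Hl H.
have P0 := P_neq0; have C0 := ncols_gt0 P_tableau P0.
have sub A : subseq [seq x <- oneline s | A x] (oneline s) := filter_subseq _ _.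
split; apply/eqP; rewrite eqn_leq leqNgt (introN idP) //=.
  have [//||] := H n.+1; first by lia.
    by move/(contains_sub (sub _))/incr_onelineE.
  rewrite (@eq_in_filter _ _ pred0) ?filter_pred0 => [[u []]|x /oneline_range]; last by move=> /=; lia.
  by rewrite subseq0 => /eqP-> /= El; move: Hl; rewrite -El.
have [//||] := H 1.
  rewrite (@eq_in_filter _ _ pred0) ?filter_pred0 => [[u []]|x /oneline_range]; last by move=> /=; lia.
  by rewrite subseq0 => /eqP-> /= Ek; move: Hk; rewrite -Ek.
by move/(contains_sub (sub _))/decr_onelineE.
Qed.

End OneWord.

Theorem theorem35 (k l n : nat) (hk : 0 < k) (hl : 0 < l) (hn : 0 < n)
    (s : 'S_n) (P Q : tableau) (hPQ : RSK (oneline s) = (P, Q)) :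
  quadrocrucial k l (oneline s) <->
  [/\ ncols P = k - 1 /\ ncols Q = k - 1,
      nrows P = l - 1 /\ nrows Q = l - 1,
      chain_by_rows P (l - 1) (k - 1),
      chain_by_cols P (l - 1) (k - 1) &
      chain_by_rows Q (l - 1) (k - 1) /\
      chain_by_cols Q (l - 1) (k - 1)].
Proof.
case: k hk => // k _; case: l hl => // l _; rewrite !subn1 /= quadrocrucialE.
have P_def : P = (RSK (oneline s)).1 by rewrite hPQ.
have Q_def : Q = (RSK (oneline s^-1)%g).1 by rewrite RSK_inv hPQ.
have Nk : contains ltn k.+1 (oneline s) <-> contains ltn k.+1 (oneline s^-1)%g.
  by rewrite !oneline_subword incr_subword_inv.
have Nl : contains gtn l.+1 (oneline s) <-> contains gtn l.+1 (oneline s^-1)%g.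
  by rewrite !oneline_subword decr_subword_inv.
split=> [[Hk Hl [Hr Hle] Ha Hb]|[[Pk Qk] [Pl Ql] Pr Pc [Qr Qc]]].
  have [Pk Pl] := critical_right_shape hn P_def Hk Hl Hr.
  have [||Qk Ql] := critical_right_shape hn Q_def _ _ Ha; [tauto|tauto|].
  split=> //; try split=> //.
  - exact/(critical_rightE hn P_def).
  - exact/(critical_leftE hn P_def).
  - exact/(critical_rightE hn Q_def).
  - exact/(critical_leftE hn Q_def).
split.
- by rewrite (incr_onelineE P_def) Pk ltnn.
- by rewrite (decr_onelineE P_def) Pl ltnn.
- by split; [apply/(critical_rightE hn P_def) | apply/(critical_leftE hn P_def)].
- exact/(critical_rightE hn Q_def).
- exact/(critical_leftE hn Q_def).
Qed.
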